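(* $P_3+P_3$ is not proportionally $(2,4)$-choosable.
   Context: All graphs are nonempty, finite and simple. $P_n$ denotes the path on $n$ vertices, and $G_1+G_2$ denotes the disjoint union of vertex-disjoint graphs $G_1$ and $G_2$. For $m\in\mathbb{N}=\{1,2,3,\ldots\}$, $[m]=\{1,\ldots,m\}$. For integers $1\le k\le \ell$, a $(k,\ell)$-assignment for a graph $G$ is a function $L$ assigning to each vertex $v$ of $G$ a set $L(v)\subseteq[\ell]$ with $|L(v)|=k$. Let $\mathcal{L}=\bigcup_{v\in V(G)}L(v)$ and, for $c\in\mathcal{L}$, let $\eta(c)=|\{v\in V(G): c\in L(v)\}|$. A proportional $L$-coloring of $G$ is a function $f$ on $V(G)$ with $f(v)\in L(v)$ for every $v$, with $f(u)\ne f(v)$ whenever $u,v$ are adjacent, and with $|f^{-1}(c)|\in\{\lfloor \eta(c)/k\rfloor,\lceil \eta(c)/k\rceil\}$ for every $c\in\mathcal{L}$. $G$ is proportionally $(k,\ell)$-choosable if a proportional $L$-coloring of $G$ exists for every $(k,\ell)$-assignment $L$ for $G$. *)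

(* Defs.v *)
From mathcomp Require Import all_boot.

Set Implicit Arguments.
Unset Strict Implicit.
Unset Printing Implicit Defensive.

Record sgraph := SGraph {
  vertex :> finType;
  adj : rel vertex;
  adj_sym : symmetric adj;
  adj_irrefl : irreflexive adj
}.

Definition path_adj (n : nat) : rel 'I_n :=
  fun i j => (i.+1 == j :> nat) || (j.+1 == i :> nat).

Lemma path_adj_sym n : symmetric (@path_adj n).
Proof. by move=> i j; rewrite /path_adj orbC. Qed.

Lemma path_adj_irrefl n : irreflexive (@path_adj n).
Proof. by move=> i; rewrite /path_adj orbb eqn_leq ltnn. Qed.

Definition path_graph (n : nat) : sgraph :=
  SGraph (@path_adj_sym n) (@path_adj_irrefl n).

Definition union_adj (G1 G2 : sgraph) : rel (G1 + G2)%type :=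
  fun x y => match x, y with
             | inl u, inl v => adj u v
             | inr u, inr v => adj u v
             | _, _ => false
             end.

Lemma union_adj_sym G1 G2 : symmetric (@union_adj G1 G2).
Proof. by case=> u [] v //=; rewrite /= adj_sym. Qed.

Lemma union_adj_irrefl G1 G2 : irreflexive (@union_adj G1 G2).
Proof. by case=> u /=; rewrite adj_irrefl. Qed.

Definition disjoint_union (G1 G2 : sgraph) : sgraph :=
  SGraph (@union_adj_sym G1 G2) (@union_adj_irrefl G1 G2).

Definition ceil_divn (m d : nat) : nat := (m + d.-1) %/ d.

Lemma ceil_divn_leq m d q : 0 < d -> (ceil_divn m d <= q) = (m <= q * d).
Proof.
case: d => // d _; rewrite /ceil_divn /= -ltnS ltn_divLR // mulSn.
by rewrite addnC addSn ltnS leq_add2l.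
Qed.

(* The color set {1, ..., l} is represented by 'I_l = {0, ..., l - 1}. *)
Section ListColoring.

Variables (G : sgraph) (k l : nat).
Implicit Types (L : G -> {set 'I_l}) (f : G -> 'I_l).

(* Meant for 1 <= k <= l. *)
Definition is_assignment L : Prop := forall v, #|L v| = k.

Definition palette L : {set 'I_l} := \bigcup_(v : G) L v.

Definition eta L (c : 'I_l) : nat := #|[set v : G | c \in L v]|.

Definition proportional_coloring L f : Prop :=
  [/\ forall v, f v \in L v,
      forall u v, adj u v -> f u != f v &
      forall c, c \in palette L ->
        #|[set v | f v == c]| = eta L c %/ k \/
        #|[set v | f v == c]| = ceil_divn (eta L c) k].

Definition proportionally_choosable : Prop :=
  forall L, is_assignment L -> exists f, proportional_coloring L f.

End ListColoring.

Arguments proportionally_choosable G k l : clear implicits.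

(* Main.v *)
Require Import Defs.
From mathcomp Require Import all_boot.

(** Give every vertex the color 0 and one further color: 1 to both ends of the
    first path, 3 to both ends of the second path, 2 to both middle vertices.
    Each color other than 0 lies on exactly two lists, so it is used exactly
    once, and hence exactly one of its two vertices is colored 0.  Thus one of
    the two middle vertices is colored 0, and so is one of its neighbors. *)

Notation P3P3 := (disjoint_union (path_graph 3) (path_graph 3)).

Definition extra_color (v : P3P3) : 'I_4 :=
  match v with
  | inl i => if val i == 1 then @Ordinal 4 2 isT else @Ordinal 4 1 isT
  | inr i => if val i == 1 then @Ordinal 4 2 isT else @Ordinal 4 3 isT
  end.

Definition bad_lists (v : P3P3) : {set 'I_4} := [set ord0; extra_color v].

Lemma extra_color_neq0 v : extra_color v != ord0.
Proof. by case: v => i /=; case: ifP. Qed.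

Lemma bad_lists_assignment : is_assignment 2 bad_lists.
Proof. by move=> v; rewrite /bad_lists cards2 eq_sym extra_color_neq0. Qed.

(** The shared extra color may be used only once, and only at [u] or [v]; the other of the two has
    no choice left but [ord0]. *)
Lemma proportional_one_zero f (u v : P3P3) :
    proportional_coloring 2 bad_lists f -> u != v ->
    (forall w, (extra_color w == extra_color u) = (w \in [set u; v])) ->
  (f u == ord0) = (f v != ord0).
Proof.
case=> fL _ fprop uv fibre; set c := extra_color u in fibre.
have c0 : c != ord0 := extra_color_neq0 u.
have cv : extra_color v = c by apply/eqP; rewrite fibre set22.
have inL w : (c \in bad_lists w) = (w \in [set u; v]).
  by rewrite !inE (negbTE c0) eq_sym fibre !inE.
have eta_c : eta bad_lists c = 2.
  rewrite /eta; have -> : [set w | c \in bad_lists w] = [set u; v].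
    by apply/setP=> w; rewrite inE inL.
  by rewrite cards2 uv.
have cpal : c \in palette bad_lists by apply/bigcupP; exists u; rewrite ?inL ?set21.
(* Floor and ceiling of [2 / 2] agree, so both alternatives give 1. *)
have /eqP/cards1P[w class_c] : #|[set w | f w == c]| = 1.
  by case: (fprop c cpal) => ->; rewrite eta_c.
have f_c x : (f x == c) = (x == w).
  by have /setP/(_ x) := class_c; rewrite !inE.
have fE x : extra_color x = c -> (f x == ord0) = (f x != c).
  move=> xc; have := fL x; rewrite /bad_lists xc !inE.
  by case/orP=> /eqP ->; rewrite ?eqxx ?(negbTE c0) // eq_sym c0.
rewrite !fE // negbK !f_c.
(* The goal is now [(u != w) = (v == w)]: it suffices that [w], having [c] on its list, is [u] or
   [v]. *)
have : w \in [set u; v].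
  by rewrite -inL; have /eqP <- : f w == c by rewrite f_c.
by rewrite !inE => /orP[] /eqP ->; rewrite eqxx ?uv // eq_sym (negbTE uv).
Qed.

Theorem proposition15 :
  ~ proportionally_choosable (disjoint_union (path_graph 3) (path_graph 3)) 2 4.
Proof.
move=> /(_ _ bad_lists_assignment)[f fP].
pose i0 := @Ordinal 3 0 isT; pose i1 := @Ordinal 3 1 isT.
pose i2 := @Ordinal 3 2 isT.
have no00 u v : adj u v -> f u == ord0 -> f v == ord0 -> False.
  by case: fP => _ /(_ u v) fadj _ /fadj uv /eqP fu /eqP fv; rewrite fu fv in uv.
have ends1 : (f (inl i0) == ord0) = (f (inl i2) != ord0).
  (* The condition on [extra_color] is checked at each of the six vertices. *)
  by apply: proportional_one_zero fP _ _ => // -[] [] [|[|[|]]] // ?; rewrite !inE.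
have ends2 : (f (inr i0) == ord0) = (f (inr i2) != ord0).
  by apply: proportional_one_zero fP _ _ => // -[] [] [|[|[|]]] // ?; rewrite !inE.
have middles : (f (inl i1) == ord0) = (f (inr i1) != ord0).
  by apply: proportional_one_zero fP _ _ => // -[] [] [|[|[|]]] // ?; rewrite !inE.
(* In the path whose middle is colored [ord0], one end is too, and it is adjacent to the middle. *)
have [m1|m1] := boolP (f (inl i1) == ord0).
  have [e|e] := boolP (f (inl i0) == ord0).
    exact: (no00 (inl i0) (inl i1)).
  by apply: (no00 (inl i1) (inl i2)) => //; rewrite -[_ == _]negbK -ends1.
have m2 : f (inr i1) == ord0 by rewrite -[_ == _]negbK -middles.
have [e|e] := boolP (f (inr i0) == ord0).
  exact: (no00 (inr i0) (inr i1)).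
by apply: (no00 (inr i1) (inr i2)) => //; rewrite -[_ == _]negbK -ends2.
Qed.
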